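(* Let $m\ge1$ be an integer and $n\in\mathbb{Z}$. For $h\in\mathbb{C}_{\geq1}[[z]]$, the entry $[\exp\langle h\rangle]^m_n$ is an entire function of $h_1,\ldots,h_{n-m+1}$. For $h\in\mathbb{C}_{\leq1}[[1/z]]$, the entry $[\exp\langle h\rangle]^m_n$ is an entire function of $h_{n-m+1},\ldots,h_1$.
   Context: $\mathbb{C}_{\geq 1}[[z]]$ is the vector space of all formal series $h(z)=\sum_{n\geq 1}h_nz^n$ with complex coefficients, and $\mathbb{C}_{\leq 1}[[1/z]]$ is the vector space of all formal series $h(z)=\sum_{n\le 1}h_nz^n$. Matrices are doubly infinite, indexed by $\mathbb{Z}\times\mathbb{Z}$; $[A]^m_n$ is the entry in row $m$, column $n$. For such $h$, $\langle h\rangle$ is the matrix with entry $m\,h_{n-m+1}$ in row $m$ and column $n$ ($h_j=0$ when $z^j$ does not occur in $h$); it is upper (resp. lower) triangular. $\exp\langle h\rangle=\sum_{j\ge0}\frac1{j!}\langle h\rangle^j$ is the matrix exponential, understood entrywise (products are finite sums and each entry converges). ''Entire function of $h_i,\dots,h_j$'' means the entry is given, for all $h$, by one fixed entire function evaluated at these coefficients (a constant if the list is empty). *)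

(* Defs.v *)
From mathcomp Require Import all_boot all_order all_algebra.
From mathcomp Require Import all_classical all_reals all_analysis.
From mathcomp Require Import complex.

Set Implicit Arguments.
Unset Strict Implicit.
Unset Printing Implicit Defensive.

Import Order.TTheory GRing.Theory Num.Theory numFieldNormedType.Exports.

Local Open Scope classical_set_scope.
Local Open Scope ring_scope.

(* The complex numbers over the reals R.  The regular module R[i]^o (convertible
   to R[i]) is the type that carries the usual topology and norm. *)
Notation Cplx R := (R[i]^o).

(* Doubly infinite matrices; A m n is the entry in row m, column n. *)
Definition zmatrix (R : realType) := int -> int -> Cplx R.

(* A formal Laurent series is its coefficient family: h j multiplies z^j. *)
Definition series_ge1 (R : realType) : set (int -> Cplx R) :=
  [set h | forall j : int, j < 1 -> h j = 0].

Definition series_le1 (R : realType) : set (int -> Cplx R) :=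
  [set h | forall j : int, 1 < j -> h j = 0].

Definition zmx_of_series (R : realType) (h : int -> Cplx R) : zmatrix R :=
  fun m n => m%:~R * h (n - m + 1).

Definition zmx1 (R : realType) : zmatrix R := fun m n => (m == n)%:R.

(* The sum has finite support for two upper, or two lower, triangular factors
   (with infinite support the finitely supported sum is 0 by convention). *)
Definition zmx_mul (R : realType) (A B : zmatrix R) : zmatrix R :=
  fun m n => \sum_(k \in [set: int]) A m k * B k n.

Definition zmx_pow (R : realType) (A : zmatrix R) (j : nat) : zmatrix R :=
  iter j (zmx_mul A) (@zmx1 R).

Definition zmx_exp_partial (R : realType) (A : zmatrix R) (m n : int) :
  nat -> Cplx R := series (fun j : nat => (j`!%:R)^-1 * zmx_pow A j m n).

(* Only meaningful where the partial sums converge. *)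
Definition zmx_exp (R : realType) (A : zmatrix R) : zmatrix R :=
  fun m n => limn (zmx_exp_partial A m n).

(* Everywhere Frechet differentiable over the complex scalars, i.e. holomorphic
   on C^k; for k = 0 the domain is a point. *)
Definition entire (R : realType) (k : nat) (F : 'rV[Cplx R]_k -> Cplx R) :=
  forall x, differentiable F x.

(* The length b - a + 1 of the list h_a, ..., h_b, or 0 when b < a. *)
Definition ncoefs (a b : int) : nat := absz (Num.max 0 (b - a + 1)).

Definition coefs (R : realType) (h : int -> Cplx R) (a b : int) :
  'rV[Cplx R]_(ncoefs a b) := \row_(i < ncoefs a b) h (a + (i : nat)%:Z).

(* On S, the quantity E h is an entire function of h_a, ..., h_b. *)
Definition entire_function_of_coefs (R : realType) (S : set (int -> Cplx R))
    (E : (int -> Cplx R) -> Cplx R) (a b : int) :=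
  exists F : 'rV[Cplx R]_(ncoefs a b) -> Cplx R,
    entire F /\ forall h, S h -> E h = F (coefs h a b).

(* Main.v *)
(* On a triangular matrix, the entry (m, n) of a power only involves the indices
   in the finite interval between m and n, hence only the coefficients of h
   between h_1 and h_(n-m+1), on which the truncated matrix A depends linearly.
   Write C for a bound on the row sums of A and A + B, where those of B are at
   most C r.  By induction on j, the entries of the powers satisfy
     |(A + B)^j - A^j - D_j(A; B)| <= j^2 C^j r^2,
   with D_j(A; B) linear in B and at most j C^j r.  As j^2 <= 4^j, dividing by j!
   and summing gives a Frechet differential of exp A with a quadratic remainder. *)
Require Import Defs.
From HB Require Import structures.
From mathcomp Require Import all_boot all_order all_algebra.
From mathcomp Require Import all_classical all_reals all_analysis.
From mathcomp Require Import complex.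
From mathcomp Require Import ring zify.

Set Implicit Arguments.
Unset Strict Implicit.
Unset Printing Implicit Defensive.

Import Order.TTheory GRing.Theory Num.Theory numFieldNormedType.Exports.
Local Open Scope classical_set_scope.
Local Open Scope ring_scope.

(** * Powers of a matrix over a finite index list, with their second-order Taylor estimate *)

Section FiniteWindowPowers.
Variables (K : numDomainType) (T : eqType) (s : seq T).
Implicit Types (A B : T -> T -> K).

Fixpoint fin_pow A (j : nat) : T -> T -> K :=
  if j is j'.+1 then fun k l => \sum_(t <- s) A k t * fin_pow A j' t l
  else fun k l => (k == l)%:R.

(* The differential at A, in the direction B, of the j-th power. *)
Fixpoint fin_dpow A B (j : nat) : T -> T -> K :=
  if j is j'.+1 then fun k l =>
    \sum_(t <- s) (B k t * fin_pow A j' t l + A k t * fin_dpow A B j' t l)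
  else fun _ _ => 0.

(** This bounds the operator norm for the sup norm on [s]. That norm is submultiplicative, so powers
    obey [c ^+ j] with no factor counting the elements of [s]. *)
Definition row_bounded A (c : K) :=
  forall k, k \in s -> \sum_(t <- s) `|A k t| <= c.

Lemma fin_mul_norm_le A (P : T -> T -> K) (c p : K) (k l : T) : 0 <= p ->
  row_bounded A c -> (forall t, t \in s -> `|P t l| <= p) -> k \in s ->
  `|\sum_(t <- s) A k t * P t l| <= c * p.
Proof.
move=> p0 Ac Pp ks; apply: (le_trans (ler_norm_sum _ _ _)).
apply: le_trans (_ : (\sum_(t <- s) `|A k t|) * p <= _); last first.
  by rewrite ler_wpM2r// Ac.
rewrite mulr_suml big_seq [leRHS]big_seq; apply: ler_sum => t ts.
by rewrite normrM ler_wpM2l// Pp.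
Qed.

Lemma fin_pow_norm_le A (c : K) (j : nat) (k l : T) : 0 <= c ->
  row_bounded A c -> k \in s -> `|fin_pow A j k l| <= c ^+ j.
Proof.
move=> c0 Ac; elim: j k => [|j IH] k ks /=.
  by rewrite expr0; case: eqP; rewrite ?normr1 ?normr0.
by rewrite exprS; apply: fin_mul_norm_le => //; exact: exprn_ge0.
Qed.

Variables (A B : T -> T -> K) (c r : K).
Hypotheses (c0 : 0 <= c) (r0 : 0 <= r).
Hypotheses (Ac : row_bounded A c) (Bc : row_bounded B (c * r)).

Let AB k l := A k l + B k l.
Hypothesis ABc : row_bounded AB c.

(** Telescoping gives [j] products, each with one factor [B]. Since [B] has row bound [c * r], such
    a factor costs [r] and the power of [c] stays [j]. *)
Lemma fin_powD_norm_le (j : nat) (k l : T) : k \in s ->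
  `|fin_pow AB j k l - fin_pow A j k l| <= j%:R * c ^+ j * r.
Proof.
elim: j k => [|j IH] k ks; first by rewrite /= subrr normr0 !mul0r.
(* Peel off the leftmost factor: (A+B)^(j+1) - A^(j+1) = (A+B)((A+B)^j - A^j) + B A^j. *)
have -> : fin_pow AB j.+1 k l - fin_pow A j.+1 k l =
    \sum_(t <- s) AB k t * (fin_pow AB j t l - fin_pow A j t l) +
    \sum_(t <- s) B k t * fin_pow A j t l.
  rewrite /= -sumrB -big_split/=; apply: eq_bigr => t _.
  by rewrite /AB; ring.
apply: (le_trans (ler_normD _ _)).
apply: (@le_trans _ _ (c * (j%:R * c ^+ j * r) + c * r * c ^+ j)).
  apply: lerD.
    apply: (@fin_mul_norm_le AB (fun t l => fin_pow AB j t l - fin_pow A j t l))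
      => //.
    by rewrite !mulr_ge0// exprn_ge0.
  apply: fin_mul_norm_le => //; first exact: exprn_ge0.
  by move=> t ts; apply: fin_pow_norm_le.
by rewrite exprS -natr1 le_eqVlt; apply/orP; left; apply/eqP; ring.
Qed.

Lemma fin_dpow_norm_le (j : nat) (k l : T) : k \in s ->
  `|fin_dpow A B j k l| <= j%:R * c ^+ j * r.
Proof.
elim: j k => [|j IH] k ks; first by rewrite /= normr0 !mul0r.
rewrite /= big_split/=.
apply: (le_trans (ler_normD _ _)).
apply: (@le_trans _ _ (c * r * c ^+ j + c * (j%:R * c ^+ j * r))).
  apply: lerD; apply: fin_mul_norm_le => //.
  - exact: exprn_ge0.
  - by move=> t ts; apply: fin_pow_norm_le.
  - by rewrite !mulr_ge0// exprn_ge0.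
by rewrite exprS -natr1 le_eqVlt; apply/orP; left; apply/eqP; ring.
Qed.

Lemma fin_pow_taylor_le (j : nat) (k l : T) : k \in s ->
  `|fin_pow AB j k l - fin_pow A j k l - fin_dpow A B j k l|
    <= j%:R ^+ 2 * c ^+ j * r ^+ 2.
Proof.
elim: j k => [|j IH] k ks.
  by rewrite /= subrr subr0 normr0 expr0n !mul0r.
(* The remainder splits into [B] times the first-order difference, of order r^2, and [A] times the
   previous remainder. *)
have -> : fin_pow AB j.+1 k l - fin_pow A j.+1 k l - fin_dpow A B j.+1 k l =
    \sum_(t <- s) B k t * (fin_pow AB j t l - fin_pow A j t l) +
    \sum_(t <- s) A k t *
      (fin_pow AB j t l - fin_pow A j t l - fin_dpow A B j t l).
  rewrite /= -!sumrB -big_split/=; apply: eq_bigr => t _.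
  rewrite /AB; ring.
apply: (le_trans (ler_normD _ _)).
apply: (@le_trans _ _ (c * r * (j%:R * c ^+ j * r) +
    c * (j%:R ^+ 2 * c ^+ j * r ^+ 2))).
  apply: lerD.
    apply: (@fin_mul_norm_le B (fun t l => fin_pow AB j t l - fin_pow A j t l))
      => //; first by rewrite !mulr_ge0// exprn_ge0.
    by move=> t ts; apply: fin_powD_norm_le.
  apply: (@fin_mul_norm_le A (fun t l =>
    fin_pow AB j t l - fin_pow A j t l - fin_dpow A B j t l)) => //.
  by rewrite !mulr_ge0// exprn_ge0.
have -> : c * r * (j%:R * c ^+ j * r) + c * (j%:R ^+ 2 * c ^+ j * r ^+ 2) =
    (j%:R + j%:R ^+ 2) * (c ^+ j.+1 * r ^+ 2) by rewrite (exprS c); ring.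
rewrite -mulrA ler_wpM2r ?mulr_ge0 ?exprn_ge0//.
(* The recursion produces j + j^2, which is at most (j+1)^2. *)
rewrite -natrX -natrD -natrX ler_nat; nia.
Qed.

End FiniteWindowPowers.

(** * Convergence and norm bounds for complex series with a real majorant *)

Section ComplexSeries.
Variable R : realType.
Local Open Scope complex_scope.
Implicit Types (u : nat -> Cplx R) (b : nat -> R).

Lemma normC_le (z : R[i]) :
  `|z| <= (`|complex.Re z| + `|complex.Im z|)%:C.
Proof.
rewrite {1}[z]complexE rmorphD/=; apply: (le_trans (ler_normD _ _)).
rewrite normrM !normc_def/= !expr0n/= !addr0 add0r expr1n sqrtr1 mul1r.
by rewrite !sqrtr_sqr.
Qed.

Lemma norm_ReC_le (z : R[i]) (r : R) : `|z| <= r%:C -> `|complex.Re z| <= r.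
Proof. by move=> zr; rewrite -lecR (le_trans (normc_ge_Re z)). Qed.

Lemma norm_ImC_le (z : R[i]) (r : R) : `|z| <= r%:C -> `|complex.Im z| <= r.
Proof.
(* Multiplication by i preserves the norm and turns the imaginary part into minus a real part. *)
move=> zr; rewrite -normrN -ReiNIm norm_ReC_le// normrM.
by rewrite [X in _ * X]normc_def/= expr0n/= add0r expr1n sqrtr1 mulr1.
Qed.

Lemma cvgC (u : nat -> Cplx R) (x y : R) :
  complex.Re (u n) @[n --> \oo] --> x -> complex.Im (u n) @[n --> \oo] --> y ->
  u @ \oo --> (x +i* y : Cplx R).
Proof.
move=> ux uy; apply/cvgrPdist_le => /= e e0.
(* The norm takes values in [R[i]], so [e] is a complex number; [0 < e] forces it to be real. *)
have er : (complex.Re e)%:C = e by rewrite RRe_real// gtr0_real.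
have e20 : 0 < complex.Re e / 2 by rewrite divr_gt0// -ltcR er.
near=> n.
apply: (le_trans (normC_le _)); rewrite -er lecR [leRHS]splitr.
have -> : complex.Re ((x +i* y) - u n) = x - complex.Re (u n).
  by case: (u n).
have -> : complex.Im ((x +i* y) - u n) = y - complex.Im (u n).
  by case: (u n).
by apply: lerD; near: n; [move/cvgrPdist_le: ux | move/cvgrPdist_le: uy]; exact.
Unshelve. all: by end_near. Qed.

Lemma ReC_series u n :
  complex.Re (series u n) = series (fun j => complex.Re (u j)) n.
Proof.
by apply: (big_morph (fun z : R[i] => complex.Re z)) => // -[? ?] [].
Qed.

Lemma ImC_series u n :
  complex.Im (series u n) = series (fun j => complex.Im (u j)) n.
Proof.
by apply: (big_morph (fun z : R[i] => complex.Im z)) => // -[? ?] [].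
Qed.

(** Real and imaginary parts are both dominated by [b], so the real comparison test applies to
    each. *)
Lemma dominated_seriesC_cvg u b : (forall j, `|u j| <= (b j)%:C) ->
  cvgn (series b) -> cvgn (series u).
Proof.
move=> ub cb.
have dom (v : nat -> R) : (forall j, `|v j| <= b j) -> cvgn (series v).
  move=> vb; apply: normed_cvg.
  by apply: (series_le_cvg _ _ vb cb) => j //; apply: le_trans (vb j).
have cR : cvgn (series (fun j => complex.Re (u j))).
  by apply: dom => j; exact: norm_ReC_le.
have cI : cvgn (series (fun j => complex.Im (u j))).
  by apply: dom => j; exact: norm_ImC_le.
apply/cvg_ex; eexists; apply: (@cvgC (series u)).
- by rewrite (eq_cvg _ _ (ReC_series u)); exact: cR.
- by rewrite (eq_cvg _ _ (ImC_series u)); exact: cI.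
Qed.

Lemma norm_limC_le (u : nat -> Cplx R) (c : R[i]) :
  cvgn u -> (forall n, `|u n| <= c) -> `|limn u| <= c.
Proof.
move=> cu uc; apply/ler_addgt0Pr => e e0.
have [n _ /(_ n (leqnn n)) /= un] := (cvgrPdist_le _ _).1 cu e e0.
rewrite -[limn u](subrK (u n)); apply: (le_trans (ler_normD _ _)).
by rewrite addrC lerD.
Qed.

(** Keeping [r] apart from the majorant gives a constant independent of [r], which later is the norm
    of the increment or its square. *)
Lemma norm_seriesC_le u b (r : R[i]) : 0 <= r ->
  (forall j, 0 <= b j) -> (forall j, `|u j| <= (b j)%:C * r) ->
  cvgn (series b) ->
  cvgn (series u) /\ `|limn (series u)| <= (limn (series b))%:C * r.
Proof.
move=> r0 b0 ubr cb.
have rE : (complex.Re r)%:C = r by rewrite RRe_real// ger0_real.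
have cu : cvgn (series u).
  apply: (@dominated_seriesC_cvg u (complex.Re r *: b)) => [j|].
    have -> : ((complex.Re r *: b) j)%:C = (b j)%:C * r.
      by rewrite -[in RHS]rE -rmorphM mulrC.
    exact: ubr.
  exact: is_cvg_seriesZ.
split => //; apply: norm_limC_le => // n.
apply: (le_trans (ler_norm_sum _ _ _)).
apply: (@le_trans _ _ (\sum_(0 <= j < n) (b j)%:C * r)); first exact: ler_sum.
rewrite -mulr_suml -rmorph_sum ler_wpM2r// lecR.
apply: nondecreasing_cvgn_le => //.
exact: nondecreasing_series.
Qed.

End ComplexSeries.

(** A quadratic remainder is little-o of the increment, and the linear bound makes [L] continuous,
    so [L] is the differential. *)
Lemma quadratic_remainder_differentiable (K : numFieldType)
    (V W : normedModType K) (f : V -> W) (L : {linear V -> W}) (x : V) (c : K) :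
  (forall v, `|L v| <= c * `|v|) ->
  (forall v, `|v| <= 1 -> `|f (v + x) - f x - L v| <= c * `|v| ^+ 2) ->
  differentiable f x.
Proof.
move=> Lc fc.
(* Any nonzero vector forces [c] to be nonnegative through the bound on [L]; on the zero space [f]
   is constant. *)
have [c0 | V0] : 0 <= c \/ forall v : V, v = 0.
  have [[v v0]|V0] := pselect (exists v : V, v != 0); last first.
    by right => v; apply: contrapT => v0; apply: V0; exists v; apply/eqP.
  left; rewrite -(@pmulr_lge0 _ `|v|) ?normr_gt0//.
  exact: le_trans (Lc v).
- have Lcont : continuous L.
    apply/linear_bounded_continuous/linear_boundedP.
    exists c; split; first exact: ger0_real.
    by move=> r cr v; apply: (le_trans (Lc v)); rewrite ler_wpM2r// ltW.
  have fL : f \o shift x = cst (f x) + L +o_ 0 id.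
    apply/eqaddoP => e e0.
    (* Adding 1 keeps the denominator positive when [c] is 0. *)
    have ec0 : 0 < e / (c + 1) by rewrite divr_gt0// ltr_wpDl.
    have small (d : K) : 0 < d -> \forall v \near nbhs (0 : V), `|v| <= d.
      by move=> d0; apply/nbhs_norm0P; exists d => //= v /= /ltW.
    apply: filterS2 (small _ ltr01) (small _ ec0) => v v1 ve.
    rewrite /= !fctE /= opprD addrA.
    apply: (le_trans (fc _ v1)); rewrite expr2 mulrA ler_wpM2r//.
    apply: (@le_trans _ _ ((c + 1) * `|v|)).
      by rewrite ler_wpM2r// lerDl.
    by rewrite mulrC -ler_pdivlMr ?ltr_wpDl.
  by apply/diff_locallyP; rewrite (diff_unique Lcont fL).
- have -> : f = cst (f x) by apply/funext => v; rewrite /= (V0 v) (V0 x).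
  exact: differentiable_cst.
Qed.

(** * Termwise differentiation of a dominated series of functions *)

Section SeriesOfFunctions.
Variables (R : realType) (V : normedModType R[i]).
Local Open Scope complex_scope.
Variables (f : nat -> V -> Cplx R) (l : nat -> V -> Cplx R) (b : nat -> R) (x : V).
Hypothesis l_linear : forall j, linear (l j).
Hypothesis b_ge0 : forall j, 0 <= b j.
Hypothesis b_cvg : cvgn (series b).
Hypothesis f_le : forall j v, `|v| <= 1 -> `|f j (v + x)| <= (b j)%:C.
Hypothesis l_le : forall j v, `|l j v| <= (b j)%:C * `|v|.
Hypothesis taylor_le : forall j v, `|v| <= 1 ->
  `|f j (v + x) - f j x - l j v| <= (b j)%:C * `|v| ^+ 2.

(** The differential is the sum of the [l j]. One summable majorant [b] controls values,
    differentials and remainders, so the sum of [b] serves as the constant of the quadratic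
    remainder criterion. *)
Lemma series_differentiable :
  differentiable (fun y => limn (series (fun j => f j y)) : Cplx R) x.
Proof.
have lcvg v : cvgn (series (fun j => l j v)) /\
    `|limn (series (fun j => l j v))| <= (limn (series b))%:C * `|v|.
  exact: (@norm_seriesC_le R (fun j => l j v) b).
have fcvg v : `|v| <= 1 -> cvgn (series (fun j => f j (v + x))).
  by move=> v1; apply: dominated_seriesC_cvg b_cvg => j; exact: f_le.
have f0cvg : cvgn (series (fun j => f j x)).
  by have := fcvg 0; rewrite normr0 add0r; apply.
pose L v : Cplx R := limn (series (fun j => l j v)).
have L_linear : linear L.
  move=> a u v; rewrite /L; apply: cvg_lim; first exact: norm_hausdorff.
  have -> : series (fun j => l j (a *: u + v)) =
      a *: series (fun j => l j u) + series (fun j => l j v).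
    apply/funext => n; rewrite /series/= !fctE scaler_sumr -big_split/=.
    by apply: eq_bigr => j _; rewrite l_linear.
  by apply: cvgD; [apply: cvgZl_tmp|]; apply: (lcvg _).1.
pose LL : {linear V -> Cplx R} :=
  HB.pack L (GRing.isLinear.Build _ _ _ _ L L_linear).
apply: (@quadratic_remainder_differentiable _ _ _ _ LL x
  (limn (series b))%:C) => v; first exact: (lcvg v).2.
move=> v1; rewrite /= /L.
have rcvg := @norm_seriesC_le R (fun j => f j (v + x) - f j x - l j v) b
  (`|v| ^+ 2) (exprn_ge0 _ (normr_ge0 v)) b_ge0
  (fun j => taylor_le j v1) b_cvg.
suff <- : limn (series (fun j => f j (v + x) - f j x - l j v)) =
    limn (series (fun j => f j (v + x))) - limn (series (fun j => f j x))
      - limn (series (fun j => l j v)) :> Cplx R by exact: rcvg.2.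
apply: cvg_lim; first exact: norm_hausdorff.
have -> : series (fun j => f j (v + x) - f j x - l j v) =
    series (fun j => f j (v + x)) - series (fun j => f j x) -
      series (fun j => l j v).
  by apply/funext => n; rewrite /series/= !fctE -!sumrB.
by apply: cvgB; [apply: cvgB; [exact: fcvg|]|exact: (lcvg v).1].
Qed.

End SeriesOfFunctions.

(** * The exponential of a finite matrix depending linearly on a vector *)

Section FiniteWindowExponential.
Variables (R : realType) (V : normedModType R[i]) (T : eqType) (s : seq T).
Local Open Scope complex_scope.
Variables (A : V -> T -> T -> R[i]) (c : T -> T -> R[i]).
Hypothesis A_linear : forall k l, linear (fun v => A v k l : R[i]^o).
Hypothesis A_le : forall v k l, `|A v k l| <= c k l * `|v|.
Hypothesis c_ge0 : forall k l, 0 <= c k l.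

Definition fin_exp_term (y : V) (k l : T) (j : nat) : Cplx R :=
  (j`!%:R)^-1 * fin_pow s (A y) j k l.

Lemma fin_dpow_linear x (j : nat) (k l : T) :
  linear (fun v => fin_dpow s (A x) (A v) j k l : R[i]^o).
Proof.
elim: j k => [|j IH] k a u v /=; first by rewrite scaler0 addr0.
rewrite scaler_sumr -big_split/=; apply: eq_bigr => t _.
by rewrite IH A_linear /GRing.scale/=; ring.
Qed.

Lemma fin_exp_differentiable (k l : T) (x : V) : k \in s ->
  cvgn (series (fin_exp_term x k l)) /\
  differentiable (fun y => limn (series (fin_exp_term y k l)) : Cplx R) x.
Proof.
move=> ks.
(* The sum over all rows of [s] dominates each single row. *)
pose M := \sum_(k <- s) \sum_(t <- s) c k t.
have M0 : 0 <= M by apply: sumr_ge0 => ? _; apply: sumr_ge0.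
have rowM v : row_bounded s (A v) (M * `|v|).
  move=> k' k's; apply: (@le_trans _ _ (\sum_(t <- s) c k' t * `|v|)).
    exact: ler_sum.
  rewrite -mulr_suml ler_wpM2r// /M [leRHS](big_rem k')//= lerDl.
  by apply: sumr_ge0 => ? _; apply: sumr_ge0.
(* Increments of norm at most 1 keep [v + x] within norm [|x| + 1]. Since also M <= C, the same [C]
   bounds the rows of [A x] and [A (v + x)], and [C * |v|] those of [A v]. *)
pose C := M * (`|x| + 1).
have C0 : 0 <= C by rewrite mulr_ge0// addr_ge0.
have CE : (complex.Re C)%:C = C by rewrite RRe_real// ger0_real.
have rowC v : `|v| <= 1 -> row_bounded s (A (v + x)) C.
  move=> v1 k' k's; apply: (le_trans (rowM _ _ k's)).
  by rewrite ler_wpM2l// addrC (le_trans (ler_normD _ _))// lerD2l.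
have rowx : row_bounded s (A x) C.
  by have := rowC 0; rewrite add0r normr0; apply.
(* The factor 4 absorbs the polynomial factors j and j^2 of the power estimates. *)
pose b := exp_coeff (4 * complex.Re C).
have b0 j : 0 <= b j.
  by apply: exp_coeff_ge0; rewrite mulr_ge0// -ler0c CE.
have bcvg : cvgn (series b) by exact: is_cvg_series_exp_coeff.
have bE j : (b j)%:C = (j`!%:R)^-1 * (4 ^+ j * C ^+ j).
  rewrite /b /exp_coeff/= rmorphM/= fmorphV/= rmorph_nat rmorphXn rmorphM/= CE.
  by rewrite rmorph_nat exprMn mulrC.
(* Used with [a] equal to 1, j and j^2, for the values, the differentials and the remainders. *)
have le_b (a : nat) (p r : R[i]) j : (a <= 4 ^ j)%N -> 0 <= r ->
    `|p| <= a%:R * C ^+ j * r -> `|(j`!%:R)^-1 * p| <= (b j)%:C * r.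
  move=> aj r0 pr; rewrite bE normrM ger0_norm ?invr_ge0// -mulrA.
  rewrite ler_wpM2l ?invr_ge0//; apply: (le_trans pr).
  by rewrite ler_wpM2r// ler_wpM2r ?exprn_ge0// -natrX ler_nat.
have j4 j : (j <= 4 ^ j)%N by apply/ltnW/ltn_expl.
have jj4 j : (j ^ 2 <= 4 ^ j)%N.
  by rewrite (_ : 4 = 2 ^ 2)%N// -expnM mulnC expnM leq_exp2r// ltnW// ltn_expl.
have term_le v j : `|v| <= 1 -> `|fin_exp_term (v + x) k l j| <= (b j)%:C.
  move=> v1; rewrite -[leRHS]mulr1; apply: (@le_b 1) => //.
    by rewrite expn_gt0.
  by rewrite mulr1 mul1r; apply: fin_pow_norm_le => //; exact: rowC.
split.
  apply: (@dominated_seriesC_cvg _ _ b) => // j.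
  by have := @term_le 0 j; rewrite add0r normr0; apply.
have AD v : A (v + x) = fun k l => A x k l + A v k l.
  apply/funext => k'; apply/funext => l'.
  by have := A_linear k' l' 1 v x; rewrite !scale1r addrC.
have rowMC v : row_bounded s (A v) (C * `|v|).
  move=> k' k's; apply: (le_trans (rowM v _ k's)).
  by rewrite ler_wpM2r// /C mulrDr mulr1 lerDr mulr_ge0.
apply: (@series_differentiable R V (fun j y => fin_exp_term y k l j)
  (fun j v => (j`!%:R)^-1 * fin_dpow s (A x) (A v) j k l) b) => //.
- move=> j a u v.
  rewrite fin_dpow_linear /GRing.scale/=; ring.
- by move=> j v; exact: term_le.
- move=> j v; apply: (@le_b j) => //.
  exact: fin_dpow_norm_le.
- move=> j v v1; rewrite /fin_exp_term -!mulrBr; apply: (@le_b (j ^ 2)%N) => //.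
  rewrite natrX AD; apply: fin_pow_taylor_le => //.
  by rewrite -AD; exact: rowC.
Qed.

End FiniteWindowExponential.

Lemma mx_coord_norm_le (K : numDomainType) (p q : nat) (x : 'M[K]_(p, q)) i j :
  `|x i j| <= `|x|.
Proof.
rewrite [leRHS]mx_normE -[leLHS]nngE num_le.
exact: (le_bigmax _ (fun ij : 'I_p * 'I_q => `|x ij.1 ij.2|%:nng) (i, j)).
Qed.

(** * Powers of doubly infinite triangular matrices, reduced to finite windows *)

Section TriangularPowers.
Variables (R : realType) (le : rel int).
Hypotheses (le_refl : reflexive le) (le_trans' : transitive le).
Implicit Types A : zmatrix R.

(** Taking [<=] or [>=] for [le] gives upper or lower triangular matrices, so both cases share one
    argument. *)
Definition triangular A := forall k l, ~~ le k l -> A k l = 0.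

Lemma triangular_zmx_pow A j : triangular A -> triangular (zmx_pow A j).
Proof.
move=> Atri; elim: j => [|j IH] k l kl.
  by rewrite /zmx_pow/= /zmx1; case: eqP kl => // ->; rewrite le_refl.
rewrite /zmx_pow /= /zmx_mul; apply: fsbig1 => t _.
have [kt|/Atri->] := boolP (le k t); last by rewrite mul0r.
have [tl|/IH] := boolP (le t l); last by rewrite /zmx_pow => ->; rewrite mulr0.
by rewrite (le_trans' kt tl) in kl.
Qed.

(** A nonzero term needs its summation index between [k] and [l], hence in the convex list [s]; the
    sum over all integers becomes one over [s]. *)
Lemma triangular_zmx_powE A (s : seq int) j k l : uniq s ->
  (forall t k l, k \in s -> l \in s -> le k t -> le t l -> t \in s) ->
  triangular A -> k \in s -> l \in s -> zmx_pow A j k l = fin_pow s A j k l.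
Proof.
move=> us sconv Atri ks ls; elim: j k ks => [//|j IH] k ks.
rewrite /zmx_pow /= /zmx_mul (@fsbigE _ _ _ _ _ s)//; last first.
  move=> t _ ts; apply: contraNeq ts => H.
  apply: (sconv _ _ _ ks ls); apply: contra_neqT H => H.
    by rewrite (Atri _ _ H) mul0r.
  by rewrite -/(zmx_pow A j) (triangular_zmx_pow j Atri H) mulr0.
rewrite big_mkcond/= big_seq [RHS]big_seq; apply: eq_bigr => t ts.
by rewrite in_setT -/(zmx_pow A j) IH.
Qed.

End TriangularPowers.

(** * Integer intervals, and the matrix built from finitely many coefficients *)

Definition int_window (a : int) (N : nat) : seq int :=
  [seq a + i%:Z | i <- iota 0 N.+1].

Lemma uniq_int_window a N : uniq (int_window a N).
Proof. by rewrite map_inj_uniq ?iota_uniq// => i j /addrI []. Qed.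

Lemma mem_int_window a N k : (k \in int_window a N) = (a <= k <= a + N%:Z).
Proof.
apply/mapP/idP => [[j jN ->]|akN].
  by move: jN; rewrite mem_iota; lia.
exists (absz (k - a)); last by lia.
by rewrite mem_iota; lia.
Qed.

Section CoefficientMatrix.
Variables (R : realType) (a b : int).
Local Notation N := (ncoefs a b).

(* The matrix <h> of the series h with coefficients x on [a, b], 0 elsewhere. *)
Definition coef_zmx (x : 'rV[R[i]]_N) : zmatrix R := fun k l =>
  \sum_(i < N) (if l - k + 1 == a + i%:Z then k%:~R * x 0 i else 0).

Lemma coef_zmx_linear k l : linear (fun x => coef_zmx x k l : Cplx R).
Proof.
move=> c x y; rewrite /coef_zmx scaler_sumr -big_split/=.
apply: eq_bigr => i _; case: ifP => _; last by rewrite scaler0 addr0.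
by rewrite !mxE /GRing.scale/=; ring.
Qed.

Lemma coef_zmx_le (x : 'rV[R[i]]_N) k l :
  `|coef_zmx x k l| <= (\sum_(i < N) `|k%:~R : R[i]|) * `|x|.
Proof.
rewrite mulr_suml; apply: (le_trans (ler_norm_sum _ _ _)); apply: ler_sum.
move=> i _; case: ifP => _; last by rewrite normr0 mulr_ge0.
by rewrite normrM ler_wpM2l// mx_coord_norm_le.
Qed.

Lemma coef_zmx_coefs (h : int -> Cplx R) k l :
  (~~ (a <= l - k + 1 <= b) -> h (l - k + 1) = 0) ->
  coef_zmx (coefs h a b) k l = zmx_of_series h k l.
Proof.
move=> h0; rewrite /coef_zmx /zmx_of_series.
have [abE|nab] := boolP (a <= l - k + 1 <= b); last first.
  rewrite h0 ?mulr0 ?nab//; apply: big1 => i _; case: eqP => // E; exfalso.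
  by have := ltn_ord i; rewrite [X in (_ < X)%N]/ncoefs; lia.
(* The only position of the list that contributes is [l - k + 1 - a]. *)
have iN : (absz (l - k + 1 - a)%R < N)%N by rewrite /ncoefs; lia.
rewrite (bigD1 (Ordinal iN))//= big1 ?addr0.
  rewrite mxE /=.
  have -> : a + (absz (l - k + 1 - a)%R)%:Z = l - k + 1 by lia.
  by rewrite eqxx.
move=> i /eqP i0; case: eqP => // E; exfalso; apply: i0.
by apply/val_inj => /=; lia.
Qed.

End CoefficientMatrix.

(** Starting from a row in [s], a power multiplies only entries with both indices in [s]; [l] enters
    through the identity matrix alone. *)
Lemma fin_pow_ext (K : numDomainType) (T : eqType) (s : seq T)
    (A B : T -> T -> K) j k l : k \in s ->
  (forall k l, k \in s -> l \in s -> A k l = B k l) ->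
  fin_pow s A j k l = fin_pow s B j k l.
Proof.
move=> + AB; elim: j k => [//|j IH] k ks /=; rewrite big_seq [RHS]big_seq.
by apply: eq_bigr => t ts; rewrite AB// IH.
Qed.

(** * Entries of the exponential of a triangular matrix, off and on the triangle *)

Section TriangularExponential.
Variables (R : realType) (le : rel int).
Hypotheses (le_refl : reflexive le) (le_trans' : transitive le).
Variables (S : set (int -> Cplx R)) (m n a b : int).
Hypothesis S_tri : forall h, S h -> triangular le (zmx_of_series h).

(** Convergence is asserted too because [limn] has a default value on divergent sequences. *)
Let exp_entry_is_entire :=
  (forall h, S h -> cvgn (zmx_exp_partial (zmx_of_series h) m n)) /\
  entire_function_of_coefs S (fun h => zmx_exp (zmx_of_series h) m n) a b.

Lemma triangular_zmx_exp_out : ~~ le m n -> exp_entry_is_entire.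
Proof.
move=> mn.
have E0 h : S h -> zmx_exp_partial (zmx_of_series h) m n = cst 0.
  move=> Sh; apply/funext => N; rewrite /zmx_exp_partial /series/=.
  apply: big1 => j _; rewrite (triangular_zmx_pow le_refl le_trans' _ (S_tri Sh))//.
  by rewrite mulr0.
split=> [h /E0 ->|]; first exact: is_cvg_cst.
exists (cst 0); split; first by move=> x; exact: differentiable_cst.
by move=> h /E0; rewrite /zmx_exp => ->; rewrite lim_cst//; exact: norm_hausdorff.
Qed.

Variable s : seq int.
Hypotheses (s_uniq : uniq s) (ms : m \in s) (ns : n \in s).
Hypothesis s_convex :
  forall t k l, k \in s -> l \in s -> le k t -> le t l -> t \in s.
Hypothesis S_coefs : forall h k l, S h -> k \in s -> l \in s ->
  ~~ (a <= l - k + 1 <= b) -> h (l - k + 1) = 0.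

(** On the window the matrix of [h] agrees with the one built from the listed coefficients, so each
    partial sum, and hence the limit, factors through these coefficients. *)
Lemma triangular_zmx_exp_in : exp_entry_is_entire.
Proof.
pose c (k l : int) := \sum_(i < ncoefs a b) `|k%:~R : R[i]|.
have c0 k l : 0 <= c k l by exact: sumr_ge0.
pose V : normedModType R[i] := 'rV[R[i]]_(ncoefs a b).
have [excvg exdiff] := all_and2 (fun x : V => @fin_exp_differentiable R V int s
  (@coef_zmx R a b) c (@coef_zmx_linear R a b) (@coef_zmx_le R a b) c0 m n x ms).
have E h : S h -> zmx_exp_partial (zmx_of_series h) m n =
    series (fin_exp_term s (@coef_zmx R a b) (coefs h a b) m n).
  move=> Sh; congr series; apply/funext => j; rewrite /fin_exp_term.
  rewrite (triangular_zmx_powE le_refl le_trans' _ s_uniq s_convex (S_tri Sh))//.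
  congr *%R; apply: fin_pow_ext => // k l ks ls.
  by rewrite coef_zmx_coefs//; exact: S_coefs.
split=> [h /E ->|]; first exact: excvg.
(* The entire function is the entry of the exponential of the window matrix, as a function of the
   coefficient vector. *)
eexists; split; first exact: exdiff.
by move=> h Sh; rewrite /zmx_exp E.
Qed.

End TriangularExponential.

Theorem corollary3p16 (R : realType) (m n : int) (hm : 1 <= m) :
  ((forall h, series_ge1 h -> cvgn (zmx_exp_partial (@zmx_of_series R h) m n)) /\
   entire_function_of_coefs (@series_ge1 R)
     (fun h => zmx_exp (zmx_of_series h) m n) 1 (n - m + 1))
  /\
  ((forall h, series_le1 h -> cvgn (zmx_exp_partial (@zmx_of_series R h) m n)) /\
   entire_function_of_coefs (@series_le1 R)
     (fun h => zmx_exp (zmx_of_series h) m n) (n - m + 1) 1).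
Proof.
have upper h : @series_ge1 R h -> triangular <=%R (zmx_of_series h).
  by move=> Sh k l kl; rewrite /zmx_of_series Sh ?mulr0//; lia.
have lower h : @series_le1 R h -> triangular >=%R (zmx_of_series h).
  by move=> Sh k l /= kl; rewrite /zmx_of_series Sh ?mulr0//; lia.
have ge_refl : reflexive (>=%R : rel int) by move=> ?; rewrite /= lexx.
have ge_trans : transitive (>=%R : rel int).
  by move=> y x z /= yx zy; exact: le_trans yx.
split.
(* For n < m the coefficient list is empty and the entry is the constant 0. *)
- have [mn|mn] := boolP (m <= n); last first.
    exact: (triangular_zmx_exp_out lexx le_trans) upper mn.
  apply: (@triangular_zmx_exp_in R <=%R lexx le_trans (@series_ge1 R) m n _ _ upper
    (int_window m (absz (n - m)%R))).
  + exact: uniq_int_window.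
  + by rewrite mem_int_window; lia.
  + by rewrite mem_int_window; lia.
  + by move=> t k l; rewrite !mem_int_window; lia.
  (* Inside the window [l - k + 1] is at most [n - m + 1], so an index off the list is below 1,
     where [h] vanishes. *)
  + move=> h k l Sh; rewrite !mem_int_window => *; apply: Sh; lia.
- have [mn|mn] := boolP (n <= m); last first.
    exact: (triangular_zmx_exp_out ge_refl ge_trans) lower mn.
  apply: (@triangular_zmx_exp_in R >=%R ge_refl ge_trans (@series_le1 R) m n _ _
    lower (int_window n (absz (m - n)%R))).
  + exact: uniq_int_window.
  + by rewrite mem_int_window; lia.
  + by rewrite mem_int_window; lia.
  + by move=> t k l /=; rewrite !mem_int_window; lia.
  (* Here [l - k + 1] is at least [n - m + 1], so an index off the list exceeds 1. *)
  + move=> h k l Sh; rewrite !mem_int_window => *; apply: Sh; lia.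
Qed.
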